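(* Let $p$ be the mesh pattern $(12,R)$ with $R=\{(0,0),(0,1),(0,2),(1,1),(1,2),(2,0),(2,1)\}$, let $E(t,u)=\sum_{n\ge0}t^n\sum_{\sigma\in K_n}u^{p(\sigma)}$, and let $P(t)=\sum_{n\ge0}|K_n(p)|t^n$. Then $$P(t)=\left(1+\frac{t^2}{1+t}-\frac{t^2A(t)}{(1+t)^2}\right)A(t),\qquad E(t,u)=\left(1+\frac{t^2(1-u)}{1+t}-\frac{t^2(1-u)A(t)}{(1+t)^2}\right)A(t).$$ The initial terms of $E(t,u)$ are $1+t+2t^4+14t^5+(88+2u)t^6+(634+12u)t^7+(5164+78u)t^8+\cdots$.
   Context: A permutation $\sigma=\sigma_1\cdots\sigma_n$ of $\{1,\dots,n\}$ is a king permutation if $|\sigma_{i+1}-\sigma_i|>1$ for all $1\le i\le n-1$. $K_n$ is the set of king permutations of length $n$ ($K_0$ = the empty permutation, $K_1=\{1\}$) and $A(t)=\sum_{n\ge0}|K_n|t^n$ (known to equal $\sum_{n\ge0}n!\,t^n(1-t)^n/(1+t)^n$). For a mesh pattern $p=(12,R)$ with $R\subseteq\{0,1,2\}^2$, an occurrence of $p$ in $\sigma\in S_n$ is a pair of positions $i_1<i_2$ with $\sigma_{i_1}<\sigma_{i_2}$ such that for every $(x,y)\in R$ there is no position $m$ with $i_x<m<i_{x+1}$ and $v_y<\sigma_m<v_{y+1}$, where $i_0=0$, $i_3=n+1$, $v_0=0$, $v_1=\sigma_{i_1}$, $v_2=\sigma_{i_2}$, $v_3=n+1$ (first coordinate of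 a box indexes positions, second values). $p(\sigma)$ is the number of occurrences of $p$ in $\sigma$; $K_n(p)$ is the set of king $n$-permutations with $p(\sigma)=0$. *)

(* Defs.v *)
From HB Require Import structures.
From mathcomp Require Import all_boot all_order all_algebra all_fingroup.

Set Implicit Arguments.
Unset Strict Implicit.
Unset Printing Implicit Defensive.

Import GRing.Theory.
Local Open Scope ring_scope.

(* Formal power series over R, as coefficient sequences: f n = [t^n] f.       *)
(* Equality of series is coefficientwise (=1).                                *)
Definition fps (R : Type) := nat -> R.

Declare Scope fps_scope.
Delimit Scope fps_scope with fps.
Bind Scope fps_scope with fps.

Section FormalPowerSeries.
Variable R : unitRingType.
Implicit Types f g : fps R.

Definition fpsC (c : R) : fps R := fun n => if n is 0 then c else 0.
Definition fpsX : fps R := fun n => (n == 1)%N%:R.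
Definition fps_add f g : fps R := fun n => f n + g n.
Definition fps_opp f : fps R := fun n => - f n.
Definition fps_mul f g : fps R := fun n => \sum_(k < n.+1) f k * g (n - k)%N.
Definition fps_exp f (k : nat) : fps R := iter k (fps_mul f) (fpsC 1).

(* The list of the first n coefficients of the inverse of f, obtained by      *)
(* solving f * g = 1 for one coefficient of g after the other; meaningful     *)
(* when f 0 is a unit (see fps_mulV).                                         *)
Fixpoint fps_inv_seq f (n : nat) : seq R :=
  if n is m.+1 then
    let s := fps_inv_seq f m in
    rcons s ((f 0%N)^-1 * ((m == 0)%N%:R - \sum_(k < m) f k.+1 * s`_(m - k.+1)))
  else [::].

Definition fps_inv f : fps R := fun n => (fps_inv_seq f n.+1)`_n.

Lemma size_fps_inv_seq f n : size (fps_inv_seq f n) = n.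
Proof. by elim: n => //= n IHn; rewrite size_rcons IHn. Qed.

Lemma nth_fps_inv_seq f n i : (i < n)%N -> (fps_inv_seq f n)`_i = fps_inv f i.
Proof.
elim: n => // n IHn; rewrite ltnS leq_eqVlt => /predU1P[-> //|lt_in].
by rewrite /= nth_rcons size_fps_inv_seq lt_in IHn.
Qed.

Lemma fps_invE f n :
  fps_inv f n =
    (f 0%N)^-1 * ((n == 0)%N%:R - \sum_(k < n) f k.+1 * fps_inv f (n - k.+1)%N).
Proof.
rewrite {1}/fps_inv /= nth_rcons size_fps_inv_seq ltnn eqxx.
congr (_ * (_ - _)); apply: eq_bigr => k _.
by rewrite nth_fps_inv_seq // ltn_subrL (leq_ltn_trans _ (ltn_ord k)).
Qed.

Lemma fps_mulV f : f 0%N \is a GRing.unit -> fps_mul f (fps_inv f) =1 fpsC 1.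
Proof.
move=> Uf n; rewrite /fps_mul big_ord_recl subn0 fps_invE mulVKr //=.
by rewrite subrK; case: n.
Qed.

End FormalPowerSeries.

Arguments fpsX {R}.

Notation "1" := (fpsC 1) : fps_scope.
Notation "''t'" := fpsX (at level 0) : fps_scope.
Notation "f + g" := (fps_add f g) : fps_scope.
Notation "- f" := (fps_opp f) : fps_scope.
Notation "f - g" := (fps_add f (fps_opp g)) : fps_scope.
Notation "f * g" := (fps_mul f g) : fps_scope.
Notation "f ^+ k" := (fps_exp f k) : fps_scope.
Notation "f / g" := (fps_mul f (fps_inv g)) : fps_scope.

(* 'S_n permutes {0, ..., n-1}; the paper's positions and values, which range *)
(* over {1, ..., n}, are i.+1 and (s i).+1.                                   *)
Definition king (n : nat) (s : 'S_n) : bool :=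
  [forall i : 'I_n, forall j : 'I_n,
     (j == i.+1 :> nat) ==> (1 < `|(s j)%:Z - (s i)%:Z|)].

Definition kings (n : nat) : {set 'S_n} := [set s | king s].

(* The shaded boxes R of a mesh pattern (12, R): (x, y) is the box in column  *)
(* x (positions) and row y (values).                                          *)
Definition mesh12 := {set 'I_3 * 'I_3}.

(* The grid lines i_0 < i_1 < i_2 < i_3 (resp. v_0 < v_1 < v_2 < v_3).        *)
Definition grid (n a b : nat) (k : nat) : nat := nth 0%N [:: 0; a; b; n.+1]%N k.

Definition occurrence (R : mesh12) (n : nat) (s : 'S_n) (e : 'I_n * 'I_n) :=
  let: (i1, i2) := e in
  let pos := grid n i1.+1 i2.+1 in
  let value := grid n (s i1).+1 (s i2).+1 in
  [&& (i1 < i2)%N, (s i1 < s i2)%N &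
      [forall b in R, forall m : 'I_n,
         ~~ ((pos b.1 < m.+1 < pos b.1.+1) &&
             (value b.2 < (s m).+1 < value b.2.+1))%N]].

Definition nb_occ (R : mesh12) (n : nat) (s : 'S_n) : nat :=
  #|[set e | occurrence R s e]|.

Definition kings_avoiding (R : mesh12) (n : nat) : {set 'S_n} :=
  [set s in kings n | nb_occ R s == 0%N].

Definition king_gf (R : unitRingType) : fps R := fun n => #|kings n|%:R.

Definition avoid_gf (p : mesh12) : fps int := fun n => #|kings_avoiding p n|%:R.

(* The variable u of the distribution is the polynomial indeterminate 'X.     *)
Definition distr_gf (p : mesh12) : fps {poly int} :=
  fun n => \sum_(s in kings n) 'X ^+ nb_occ p s.

Definition pat : mesh12 :=
  [set b | (val b.1, val b.2) \in
     [:: (0, 0); (0, 1); (0, 2); (1, 1); (1, 2); (2, 0); (2, 1)]%N].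

(* Main.v *)
(** Column 0 of the pattern is fully shaded, so the first entry of an occurrence
    is sigma_1 = a; the other shaded boxes then force sigma = alpha (+) beta,
    where alpha has length a and starts with its maximum a, and beta starts with
    its minimum a + 1.  Hence p(sigma) is 0 or 1.  For a king permutation sigma,
    alpha and beta are kings, and conversely the sum of two such kings is a king
    unless alpha has length 1.  If B(t) counts the kings starting with their
    minimum, deleting that minimum gives (1 + t) B = t A, and complementing
    shows that B also counts the choices of alpha.  So (B - t) B counts the
    kings with p(sigma) = 1, and E = A - (1 - u) (B - t) B. *)
From Stdlib Require Import Setoid Morphisms Ring.
Require Import Defs.
From HB Require Import structures.
From mathcomp Require Import all_boot all_order all_algebra all_fingroup.
From mathcomp Require Import zify.

Set Implicit Arguments.
Unset Strict Implicit.
Unset Printing Implicit Defensive.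

Import GRing.Theory.
Local Open Scope ring_scope.

(** * Ring structure on power series, and elimination of B *)

Section FpsRing.
Variable R : comUnitRingType.
Implicit Types f g h : fps R.

(** A named relation for [=1], to which setoid rewriting and [ring] can be attached. *)
Definition fps_eq (f g : fps (R : unitRingType)) := f =1 g.

Lemma fps_eq_equiv : Equivalence fps_eq.
Proof.
by split=> [f n | f g e n | f g h e1 e2 n]; rewrite ?e ?e1 ?e2.
Qed.

(** A coefficient of a product only sees truncations, so commutativity and associativity are
    inherited from polynomials. *)
Lemma fps_mul_poly N f g n : (n < N)%N ->
  (f * g)%fps n = ((\poly_(i < N) f i) * (\poly_(i < N) g i))`_n.
Proof.
move=> ltnN; rewrite coefM; apply: eq_bigr => i _.
have lei := ltn_ord i; rewrite !coef_poly (leq_ltn_trans _ ltnN) //.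
by rewrite (leq_ltn_trans (leq_subr _ _) ltnN).
Qed.

Lemma fps_mulC f g : (f * g =1 g * f)%fps.
Proof. by move=> n; rewrite !(@fps_mul_poly n.+1) // mulrC. Qed.

Lemma fps_mulA f g h : (f * (g * h) =1 f * g * h)%fps.
Proof.
move=> n; pose p (e : fps R) := \poly_(i < n.+1) e i.
transitivity ((p f * (p g * p h))`_n).
  rewrite coefM; apply: eq_bigr => i _; have lei := ltn_ord i.
  by rewrite (@fps_mul_poly n.+1) ?coef_poly ?lei // ltnS leq_subr.
rewrite mulrA coefM; apply: eq_bigr => i _.
by rewrite -(@fps_mul_poly n.+1) // coef_poly ltnS leq_subr.
Qed.

Lemma fps_mul1 f : (1 * f =1 f)%fps.
Proof.
move=> n; rewrite /fps_mul big_ord_recl /= subn0 mul1r big1 ?addr0 // => i _.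
by rewrite mul0r.
Qed.

Lemma fps_ring_theory :
  ring_theory (fpsC 0) (fpsC 1) (@fps_add R) (@fps_mul R)
    (fun f g => fps_add f (fps_opp g)) (@fps_opp R) fps_eq.
Proof.
split=> //.
- by move=> f [|n]; rewrite /fps_add add0r.
- by move=> f g n; rewrite /fps_add addrC.
- by move=> f g h n; rewrite /fps_add addrA.
- exact: fps_mul1.
- exact: fps_mulC.
- exact: fps_mulA.
- move=> f g h n; rewrite /fps_mul /fps_add -big_split; apply: eq_bigr => i _.
  by rewrite mulrDl.
- by move=> f [|n]; rewrite /fps_add /fps_opp subrr.
Qed.

Lemma fps_ring_ext :
  ring_eq_ext (@fps_add R) (@fps_mul R) (@fps_opp R) fps_eq.
Proof.
split=> [f f' ef g g' eg n | f f' ef g g' eg n | f f' ef n].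
- by rewrite /fps_add ef eg.
- by rewrite /fps_mul; apply: eq_bigr => i _; rewrite ef eg.
- by rewrite /fps_opp ef.
Qed.

Existing Instance fps_eq_equiv.
Instance fps_add_proper : Proper (fps_eq ==> fps_eq ==> fps_eq) (@fps_add R).
Proof. exact: Radd_ext fps_ring_ext. Qed.
Instance fps_mul_proper : Proper (fps_eq ==> fps_eq ==> fps_eq) (@fps_mul R).
Proof. exact: Rmul_ext fps_ring_ext. Qed.
Instance fps_opp_proper : Proper (fps_eq ==> fps_eq) (@fps_opp R).
Proof. exact: Ropp_ext fps_ring_ext. Qed.

Add Ring fps_ring : fps_ring_theory (setoid fps_eq_equiv fps_ring_ext).

(** Substituting B = t A / (1 + t) into (B - t) B gives t^2 A^2 / (1 + t)^2 - t^2 A / (1 + t). The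
    series [c] stands for 1 or 1 - u. *)
Lemma fps_distribution_identity (A B c q : fps (R : unitRingType)) :
    (B + 't * B =1 't * A)%fps -> (q =1 't ^+ 2 * c)%fps ->
  (A - c * ((B - 't) * B) =1
    (1 + q / (1 + 't) - q * A / (1 + 't) ^+ 2) * A)%fps.
Proof.
move=> eB eq; pose T : fps (R : unitRingType) := (1 + 't)%fps.
have eI : fps_eq (T * fps_inv T)%fps 1%fps.
  by apply: fps_mulV; rewrite /T /fps_add /= /fpsX addr0 unitr1.
have eJ : fps_eq (T ^+ 2 * fps_inv (T ^+ 2))%fps 1%fps.
  apply: fps_mulV; rewrite /T /fps_add /fps_exp /fps_mul /= /fpsX.
  by rewrite !(big_ord_recl, big_ord0) /= !(addr0, mulr1) unitr1.
rewrite -/T; move: eI eJ; set I := fps_inv T; set J := fps_inv _ => eI eJ.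
rewrite /fps_exp /= in eJ eq.
(* Uniqueness of inverses: J = J (T I)(T I) = (T^2 J) I^2 = I^2. *)
have eqJ : fps_eq J (I * I)%fps.
  transitivity (J * (T * I) * (T * I))%fps.
    by setoid_rewrite eI; ring.
  by transitivity (T * (T * 1) * J * (I * I))%fps;
    [ring | setoid_rewrite eJ; ring].
have eqB : fps_eq B (I * ('t * A))%fps.
  transitivity (T * I * B)%fps; first by setoid_rewrite eI; ring.
  have eB' : fps_eq (B + 't * B)%fps ('t * A)%fps by [].
  by setoid_rewrite <- eB'; rewrite /T; ring.
change (fps_eq q ('t * ('t * 1) * c)%fps) in eq.
suff : fps_eq (A - c * ((B - 't) * B))%fps ((1 + q * I - q * A * J) * A)%fps by [].
by setoid_rewrite eqJ; setoid_rewrite eq; setoid_rewrite eqB; ring.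
Qed.

End FpsRing.

Local Open Scope nat_scope.

(** * Permutations and kings as words on 0, ..., n-1 *)

Definition word n (s : 'S_n) : seq nat := [seq val (s i) | i <- enum 'I_n].

Lemma size_word n (s : 'S_n) : size (word s) = n.
Proof. by rewrite size_map size_enum_ord. Qed.

Lemma nth_word n (s : 'S_n) (i : 'I_n) : nth 0 (word s) i = s i.
Proof. by rewrite (nth_map i) ?nth_ord_enum ?size_enum_ord. Qed.

Lemma word_inj n : injective (@word n).
Proof.
move=> s s' e; apply/permP => i; apply/val_inj.
by rewrite /= -!nth_word e.
Qed.

Lemma perm_word n (s : 'S_n) : perm_eq (word s) (iota 0 n).
Proof.
have Uw : uniq (word s).
  by rewrite map_inj_uniq ?enum_uniq // => i j /val_inj/perm_inj.
have sub : {subset word s <= iota 0 n}.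
  by move=> x /mapP[i _ ->]; rewrite mem_iota /=.
have [|_ e] := uniq_min_size Uw sub; first by rewrite size_word size_iota.
by apply: uniq_perm; rewrite ?iota_uniq.
Qed.

Lemma perm_words n :
  perm_eq [seq word s | s <- enum 'S_n] (permutations (iota 0 n)).
Proof.
have Uw : uniq [seq word s | s <- enum 'S_n].
  by rewrite map_inj_uniq ?enum_uniq //; apply: word_inj.
have sub : {subset [seq word s | s <- enum 'S_n] <= permutations (iota 0 n)}.
  by move=> w /mapP[s _ ->]; rewrite mem_permutations perm_word.
have [|_ e] := uniq_min_size Uw sub.
  rewrite size_permutations ?iota_uniq // size_iota size_map -cardE.
  by rewrite card_Sn.
by apply: uniq_perm; rewrite ?permutations_uniq.
Qed.

(** Distance greater than 1, stated without integers or absolute values so that [lia] and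
    computation apply directly. *)
Definition far x y := (x.+1 < y) || (y.+1 < x).

Lemma king_word n (s : 'S_n) : king s = sorted far (word s).
Proof.
apply/forallP/(sortedP 0) => [ks i | ks i].
  rewrite size_word => lti.
  have /forallP/(_ (Ordinal lti))/implyP/(_ (eqxx _)) := ks (Ordinal (ltnW lti)).
  rewrite -(nth_word s (Ordinal lti)) -(nth_word s (Ordinal (ltnW lti))) /= /far.
  by lia.
apply/forallP => j; apply/implyP => /eqP ej.
have := ks i; rewrite size_word -ej ltn_ord => /(_ isT).
by rewrite !nth_word /far; lia.
Qed.

(* For the word of a permutation: w = x ++ y, where x is a permutation of
   0, ..., h starting with h, and y starts with h.+1, its minimum. *)
Definition split_word (w : seq nat) :=
  let h := head 0 w in
  [&& all (geq h) (take h.+1 w), all (ltn h) (drop h.+1 w)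
    & ohead (drop h.+1 w) == Some h.+1].

(** * Occurrences of the pattern as decompositions of the word *)

Lemma occurrence_patP n (s : 'S_n) (i1 i2 : 'I_n) :
  reflect [/\ i1 = 0 :> nat, i1 < i2, s i1 < s i2,
              forall m : 'I_n, i1 < m < i2 -> s m < s i1
            & forall m : 'I_n, i2 < m -> s i2 < s m]
          (occurrence pat s (i1, i2)).
Proof.
have neq (i j : 'I_n) : i != j :> nat -> s i != s j :> nat.
  by apply: contra => /eqP/val_inj/perm_inj->.
apply: (iffP and3P) => [[lt12 slt12 /forallP free] | [i10 lt12 slt12 mid rgt]].
  have box (x y : 'I_3) : (val x, val y) \in
     [:: (0, 0); (0, 1); (0, 2); (1, 1); (1, 2); (2, 0); (2, 1)] ->
     forall m : 'I_n,
      ~~ ((grid n i1.+1 i2.+1 x < m.+1 < grid n i1.+1 i2.+1 x.+1) &&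
         (grid n (s i1).+1 (s i2).+1 y < (s m).+1 <
           grid n (s i1).+1 (s i2).+1 y.+1)).
    by move=> inR m; have /implyP := free (x, y); rewrite inE => /(_ inR)/forallP/(_ m).
  have B x y (ltx : x < 3) (lty : y < 3) := box (Ordinal ltx) (Ordinal lty).
  have {B} [b00 b01 b02 b11 b12] :=
    And5 (B 0 0 isT isT isT) (B 0 1 isT isT isT) (B 0 2 isT isT isT)
         (B 1 1 isT isT isT) (B 1 2 isT isT isT).
  have b20 := box (Ordinal (isT : 2 < 3)) (Ordinal (isT : 0 < 3)) isT.
  have b21 := box (Ordinal (isT : 2 < 3)) (Ordinal (isT : 1 < 3)) isT.
  rewrite /grid /= in b00 b01 b02 b11 b12 b20 b21.
  split=> // [|m /andP[lt1 lt2]|m lt2].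
  (* Otherwise position 0 lies in column 0, and its letter, distinct from both letters of the
     occurrence, falls into one of the three shaded boxes there. *)
  - apply/eqP; rewrite -leqn0 leqNgt; apply/negP => i1gt0.
    have lt0n : 0 < n by apply: leq_trans (ltn_ord i1).
    pose o : 'I_n := Ordinal lt0n.
    have /implyP := neq o i1; have /implyP := neq o i2.
    move: (b00 o) (b01 o) (b02 o) (ltn_ord (s o)) => /=; lia.
  (* Column 1 leaves only its bottom box (1,0) unshaded. *)
  - have /implyP := neq m i1; have /implyP := neq m i2.
    by move: (b11 m) (b12 m) (ltn_ord (s m)); lia.
  (* Column 2 leaves only its top box (2,2) unshaded. *)
  - have /implyP := neq m i1; have /implyP := neq m i2.
    by move: (b20 m) (b21 m) (ltn_ord m) (ltn_ord (s m)); lia.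
split=> //; apply/forallP => -[[x ltx] [y lty]]; apply/implyP.
rewrite inE /= => inR; apply/forallP => m; move: (mid m) (rgt m) => /implyP + /implyP.
by move: inR; rewrite !inE !xpair_eqE; do ![case/orP]; move=> /andP[/eqP-> /eqP->];
  rewrite /grid /=; lia.
Qed.

Lemma count_geq_iota h n : h < n -> count (geq h) (iota 0 n) = h.+1.
Proof.
by move=> lthn; rewrite -size_filter (filter_iota_leq 0 lthn) size_iota.
Qed.

(** The first position is 0. Of two candidates for the second, the earlier would lie strictly
    between 0 and the later, so its letter would be below the first letter, not above it. *)
Lemma occurrence_pat_uniq n (s : 'S_n) e e' :
  occurrence pat s e -> occurrence pat s e' -> e = e'.
Proof.
case: e e' => [i1 i2] [j1 j2] /occurrence_patP[i0 lti slti midi rgti].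
move=> /occurrence_patP[j0 ltj sltj midj rgtj].
have e1 : i1 = j1 by apply: val_inj; rewrite /= i0 j0.
subst j1; congr (_, _); apply: val_inj => /=.
case: (ltngtP i2 j2) => // lt2.
  by have := midj i2; rewrite lti lt2 => /(_ isT); rewrite ltnNge ltnW.
by have := midi j2; rewrite ltj lt2 => /(_ isT); rewrite ltnNge ltnW.
Qed.

Lemma split_wordP n (s : 'S_n) :
  reflect (exists e, occurrence pat s e) (split_word (word s)).
Proof.
set w := word s; have sw : size w = n := size_word s.
have inw x : x < n -> exists i : 'I_n, s i = x :> nat.
  by move=> ltx; exists ((s^-1)%g (Ordinal ltx)); rewrite permKV.
apply: (iffP and3P) => [[/allP le_h /allP gt_h hd] | [[i1 i2]]].
  set h := head 0 w in le_h gt_h hd.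
  have ltn : h.+1 < n.
    rewrite ltnNge -sw; apply/negP => le_n; move: hd.
    by rewrite drop_oversize.
  (* The occurrence consists of the first letters of the two factors, at positions 0 and h + 1. *)
  pose i1 : 'I_n := Ordinal (ltn_trans (ltn0Sn h) ltn); pose i2 := Ordinal ltn.
  have s1 : s i1 = h :> nat by rewrite -nth_word /h -nth0.
  have s2 : s i2 = h.+1 :> nat.
    have -> : s i2 = head 0 (drop h.+1 w) :> nat.
      by rewrite -nth_word -nth0 nth_drop addn0.
    move: hd.
    by case: (drop _ _) => //= x l /eqP[].
  have neq (i j : 'I_n) : i != j :> nat -> s i != s j :> nat.
    by apply: contra => /eqP/val_inj/perm_inj->.
  exists (i1, i2); apply/occurrence_patP.
  split=> // [|m|m]; rewrite ?s1 ?s2 //=.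
    case/andP=> m0 mh; rewrite ltn_neqAle -s1 neq /=; last by rewrite -lt0n.
    rewrite s1; apply: le_h; rewrite -nth_word -/w -(nth_take _ mh) mem_nth //.
    by rewrite size_take sw ltn.
  move=> lt2; rewrite ltn_neqAle -s2 neq; last by rewrite ltn_eqF.
  rewrite s2; apply: gt_h; rewrite -nth_word -/w -(subnKC (ltnW lt2)) -nth_drop.
  by rewrite mem_nth // size_drop sw ltn_sub2r.
case/occurrence_patP=> i10 lt12 slt12 mid rgt.
have hE : head 0 w = s i1 by rewrite -(nth_word s i1) i10 nth0.
have le_h : all (geq (s i1)) (take i2 w).
  apply/(all_nthP 0) => k; rewrite size_take sw ltn_ord => ltk.
  have ltkn := ltn_trans ltk (ltn_ord i2).
  rewrite nth_take // (nth_word s (Ordinal ltkn)) /=.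
  case: (posnP k) => [k0 | k0].
    by rewrite (_ : Ordinal ltkn = i1) //; apply: val_inj; rewrite /= k0.
  by apply/ltnW/mid; rewrite /= i10 k0.
have gt_h : all (ltn (s i1)) (drop i2 w).
  apply/(all_nthP 0) => k; rewrite size_drop sw nth_drop => ltk.
  have ltkn : i2 + k < n by lia.
  rewrite (nth_word s (Ordinal ltkn)) /=.
  case: (posnP k) => [k0 | k0].
    by rewrite (_ : Ordinal ltkn = i2) //; apply: val_inj; rewrite /= k0 addn0.
  by apply/(ltn_trans slt12)/rgt; rewrite /= -[ltnLHS]addn0 ltn_add2l.
(* The letters at most [s i1] are exactly those before [i2], and 0, ..., n-1 contains [(s i1).+1] of
   them. *)
have i2E : i2 = (s i1).+1 :> nat.
  have : count (geq (s i1)) w = (s i1).+1.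
    by rewrite (seq.permP (perm_word s)) count_geq_iota.
  move <-; rewrite -(cat_take_drop i2 w) count_cat.
  move: le_h; rewrite all_count => /eqP->; rewrite size_take sw ltn_ord.
  apply/esym/eqP; rewrite -[eqbRHS]addn0 eqn_add2l -leqn0 leqNgt -has_count.
  by apply/hasPn => x /(allP gt_h) /=; rewrite -ltnNge.
rewrite hE -i2E; split=> //.
(* Here [i2] is read as the value [(s i1).+1]. It cannot occur before position [i2], where letters
   are at most [s i1], nor after it, where letters exceed [s i2], itself above [s i1]. So it is the
   letter at [i2]. *)
have [m sm] := inw i2 (ltn_ord i2).
have em : m = i2.
  apply: val_inj => /=; case: (ltngtP m i2) => // [ltm | /rgt].
    have : s m <= s i1.
      have := allP le_h (s m); rewrite /= -nth_word -/w -(nth_take _ ltm); apply.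
      by rewrite mem_nth // size_take sw ltn_ord.
    by rewrite sm i2E ltnn.
  by rewrite sm i2E ltnS leqNgt slt12.
have lt2 : i2 < size w by rewrite sw.
by rewrite (drop_nth 0 lt2) /= nth_word -{1}em sm.
Qed.

Lemma nb_occ_word n (s : 'S_n) : nb_occ pat s = split_word (word s).
Proof.
rewrite /nb_occ; case: split_wordP => [[e occ_e] | no].
  apply/eqP/cards1P; exists e; apply/setP => e'; rewrite !inE.
  by apply/idP/eqP => [occ_e' | -> //]; apply: occurrence_pat_uniq occ_e' occ_e.
apply/eqP; rewrite cards_eq0; apply/eqP/setP => e; rewrite !inE.
by apply/negP => occ_e; case: no; exists e.
Qed.

(** * Counting kings by their first letter *)

Definition king_words n := [seq w <- permutations (iota 0 n) | sorted far w].

Lemma sum_kings (V : nmodType) n (F : seq nat -> V) :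
  (\sum_(s in kings n) F (word s) = \sum_(w <- king_words n) F w)%R.
Proof.
rewrite big_filter -(perm_big _ (perm_words n)) big_map big_enum_cond /=.
by apply: eq_bigl => s; rewrite inE king_word.
Qed.

Lemma card_kings n (P : pred (seq nat)) :
  #|[set s in kings n | P (word s)]| = count P (king_words n).
Proof.
rewrite -sum1_card -sum1_count (big_mkcond P) -sum_kings -big_mkcondr.
by apply: eq_bigl => s; rewrite inE.
Qed.

Lemma perm_permutations_map (f : nat -> nat) s : uniq s -> {in s &, injective f} ->
  perm_eq (map (map f) (permutations s)) (permutations (map f s)).
Proof.
move=> Us injf.
have Uf : uniq (map (map f) (permutations s)).
  rewrite map_inj_in_uniq ?permutations_uniq // => w v.
  rewrite !mem_permutations => pw pv e.
  apply: (inj_in_map injf) e; apply/allP => x.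
    by rewrite (perm_mem pw).
  by rewrite (perm_mem pv).
have sub : {subset map (map f) (permutations s) <= permutations (map f s)}.
  by move=> _ /mapP[w + ->]; rewrite !mem_permutations; apply: perm_map.
have [|_ e] := uniq_min_size Uf sub.
  by rewrite size_map !size_permutations ?map_inj_in_uniq // size_map.
by apply: uniq_perm; rewrite ?permutations_uniq.
Qed.

Lemma count_permutations_map (f : nat -> nat) s (P : pred (seq nat)) :
    uniq s -> {in s &, injective f} ->
  count P (permutations (map f s)) = count (P \o map f) (permutations s).
Proof.
by move=> Us /(perm_permutations_map Us)/seq.permP <-; rewrite count_map.
Qed.

Definition king_from x w := sorted far w && (ohead w == Some x).

(** The coefficients of the series B. *)
Definition nb_king_from0 n := count (king_from 0) (permutations (iota 0 n)).

Lemma far_addl a : {mono addn a : x y / far x y}.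
Proof. by move=> x y; rewrite /far; lia. Qed.

(** Adding [a] to all letters preserves [far]. [P] and [Q] are the same test on the first letter
    after and before the shift; the option type covers the empty word. *)
Lemma count_king_shift (P Q : pred (option nat)) a m :
    (forall o, P (omap (addn a) o) = Q o) ->
  count (fun w => sorted far w && P (ohead w)) (permutations (iota a m)) =
  count (fun w => sorted far w && Q (ohead w)) (permutations (iota 0 m)).
Proof.
move=> ePQ; rewrite -[a in iota a]addn0 iotaDl count_permutations_map ?iota_uniq //.
  apply: eq_count => w /=; rewrite (mono_sorted (far_addl a)) -ePQ.
  by case: w.
by move=> x y _ _ /addnI.
Qed.

Lemma count_king_from a m :
  count (king_from a) (permutations (iota a m)) = nb_king_from0 m.
Proof.
apply: (@count_king_shift (pred1 (Some a)) (pred1 (Some 0))) => -[x|] //=.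
by rewrite /eq_op /= -[X in _ == X]addn0 eqn_add2l.
Qed.

(* Complementation x |-> n - 1 - x exchanges the minimal and maximal letters. *)
Lemma count_king_from_max n :
  count (king_from n.-1) (permutations (iota 0 n)) = nb_king_from0 n.
Proof.
pose f x := n.-1 - x.
have fP : {in iota 0 n &, injective f}.
  by move=> x y; rewrite !mem_iota /f; lia.
have pf : perm_eq (iota 0 n) (map f (iota 0 n)).
  have Uf : uniq (map f (iota 0 n)) by rewrite map_inj_in_uniq ?iota_uniq.
  have sub : {subset map f (iota 0 n) <= iota 0 n}.
    by move=> _ /mapP[x + ->]; rewrite !mem_iota /f; lia.
  have [|_ e] := uniq_min_size Uf sub; first by rewrite size_map.
  by rewrite perm_sym; apply: uniq_perm; rewrite ?iota_uniq.
rewrite (seq.permP (perm_permutations pf)) count_permutations_map ?iota_uniq //.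
apply: eq_in_count => w; rewrite mem_permutations => pw /=.
rewrite /king_from; congr (_ && _).
  apply: (@mono_sorted_in _ _ (fun x => x < n)).
    by move=> x y; rewrite /in_mem /= /far /f; lia.
  by apply/allP => x; rewrite (perm_mem pw) mem_iota.
case: w pw => //= x w pw.
have : x \in iota 0 n by rewrite -(perm_mem pw) mem_head.
by rewrite mem_iota /f /eq_op /=; lia.
Qed.

(** Deleting a leading 0 leaves a king on 1, ..., n that does not start with 1; after a shift, these
    are the kings of length n not counted by [nb_king_from0 n]. *)
Lemma nb_king_from0_rec n :
  nb_king_from0 n.+1 + nb_king_from0 n = size (king_words n).
Proof.
have -> : nb_king_from0 n.+1 =
    count (fun w => sorted far w && (ohead w != Some 0)) (permutations (iota 0 n)).
  rewrite -(@count_king_shift (predC1 (Some 1)) (predC1 (Some 0)) 1) => [|[x|]] //.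
  rewrite /nb_king_from0 -!size_filter -[RHS](size_map (cons 0)); apply/perm_size.
  apply: uniq_perm => [||w].
  - by rewrite filter_uniq ?permutations_uniq.
  - by rewrite map_inj_uniq ?filter_uniq ?permutations_uniq // => ? ? [].
  rewrite mem_filter mem_permutations; apply/idP/mapP.
    case: w => [|x w]; first by rewrite /king_from.
    case/andP=> /andP[sw /eqP[x0]]; subst x; rewrite perm_cons => pw.
    exists w => //; rewrite mem_filter mem_permutations pw andbT.
    case: w sw pw => //= y w /andP[fy ->] _ /=.
    by move: fy; rewrite /far; case: eqP => // -[->].
  case=> v; rewrite mem_filter mem_permutations => /andP[/andP[sv hv] pv] ->.
  rewrite [perm_eq _ _]perm_cons pv andbT /king_from eqxx andbT.
  case: v pv sv hv => //= y v pv -> /=.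
  have : y \in iota 1 n by rewrite -(perm_mem pv) mem_head.
  by rewrite mem_iota /far andbT /eq_op /=; lia.
(* The two tests on the first letter have union all kings and empty intersection. *)
rewrite /nb_king_from0 size_filter -count_predUI -[RHS]addn0; congr (_ + _).
  apply: eq_count => w /=; rewrite /king_from.
  by case: (sorted _ _); case: (_ == _).
apply/eqP; rewrite -leqn0 leqNgt -has_count; apply/hasPn => w _ /=.
by rewrite /king_from; case: (sorted _ _); case: (_ == _).
Qed.

(** * Bijection between split kings and pairs of kings *)

Lemma king_from_cat a n (x y : seq nat) : 1 < a -> a <= n ->
    perm_eq x (iota 0 a) -> king_from a.-1 x ->
    perm_eq y (iota a (n - a)) -> king_from a y ->
  [/\ perm_eq (x ++ y) (iota 0 n), sorted far (x ++ y), split_word (x ++ y)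
    & (head 0 (x ++ y)).+1 = a].
Proof.
move=> a1 le_an px /andP[sx /eqP hx] py /andP[sy /eqP hy].
have szx : size x = a by rewrite (perm_size px) size_iota.
have [h [x' [ex eh]]] : exists h x', x = h :: x' /\ h.+1 = a.
  by case: x hx {px sx szx} => // h x' [->]; exists a.-1, x'; split=> //; lia.
have [y' ey] : exists y', y = a :: y'.
  by case: y hy {py sy} => // z y' [->]; exists y'.
have Ux : uniq x by rewrite (perm_uniq px) iota_uniq.
split; last by rewrite ex.
- by rewrite -(subnKC le_an) iotaD perm_cat.
(* Only the junction is a new adjacency. As a > 1, the last letter of [x] is not its first letter a
   - 1, so it is at most a - 2, which is far from a. *)
- move: sx sy; rewrite ex ey /= cat_path /= => -> ->.
  have x'0 : x' != [::] by case: x' ex szx => // -> /=; lia.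
  have lx : last h x' \in iota 0 a by rewrite -(perm_mem px) ex mem_last.
  have : last h x' != h.
    case: x' ex x'0 {lx} => // z x' ex _; move: Ux; rewrite ex /= => /andP[nh _].
    by apply: contraNneq nh => <-; apply: mem_last.
  by move: lx; rewrite mem_iota /far andbT; lia.
- have hE : head 0 (x ++ y) = h by rewrite ex.
  rewrite /split_word hE eh.
  rewrite take_size_cat // drop_size_cat // hy eqxx andbT; apply/andP; split.
    by apply/allP => z; rewrite (perm_mem px) mem_iota /= -eh.
  by apply/allP => z; rewrite (perm_mem py) mem_iota /= -eh => /andP[].
Qed.

Lemma split_word_inv n (w : seq nat) : perm_eq w (iota 0 n) -> sorted far w -> split_word w ->
  let a := (head 0 w).+1 in
  [/\ 1 < a, a <= n, perm_eq (take a w) (iota 0 a) /\ king_from a.-1 (take a w)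
    & perm_eq (drop a w) (iota a (n - a)) /\ king_from a (drop a w)].
Proof.
move=> pw sw /and3P[]; set h := head 0 w => /= le_h gt_h hd.
have sz : size w = n by rewrite (perm_size pw) size_iota.
have le_an : h.+1 <= n.
  rewrite -sz leqNgt; apply/negP => /ltnW le_n.
  by move: hd; rewrite drop_oversize.
have ptake : perm_eq (take h.+1 w) (iota 0 h.+1).
  (* The prefix is the subword of all letters at most h, so it permutes the same filter of 0, ...,
     n-1. *)
  have -> : take h.+1 w = [seq x <- w | x < 0 + h.+1].
    rewrite -{2}(cat_take_drop h.+1 w) filter_cat.
    have /all_filterP -> : all (fun x => x < 0 + h.+1) (take h.+1 w) by [].
    rewrite (eq_in_filter (a2 := pred0)) ?filter_pred0 ?cats0 // => x.
    by move=> /(allP gt_h) /= lt_x; rewrite add0n ltnNge lt_x.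
  by rewrite -(filter_iota_ltn 0 le_an); apply: perm_filter.
have pdrop : perm_eq (drop h.+1 w) (iota h.+1 (n - h.+1)).
  move: pw; rewrite -{1}(cat_take_drop h.+1 w) -{1}(subnKC le_an) iotaD.
  by rewrite (permPl (_ : perm_eq _ (iota 0 h.+1 ++ drop h.+1 w))) ?perm_cat2l ?perm_cat2r.
have kdrop : king_from h.+1 (drop h.+1 w) by rewrite /king_from hd drop_sorted.
have ktake : king_from h (take h.+1 w).
  rewrite /king_from take_sorted //=; move: hd le_an; rewrite /h.
  by case: (w).
(* If h = 0, the word starts with 0, 1 and is not a king. *)
split=> //; rewrite ltnS lt0n; apply/negP => /eqP h0.
move: sw hd; rewrite /h in h0 *; rewrite h0; case: (w) h0 => [|x [|y v]] //= ->.
by rewrite ?drop0 => /andP[fy _] /eqP[ey]; rewrite ey in fy.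
Qed.

Lemma nb_king_from0_0 : nb_king_from0 0 = 0.
Proof. by []. Qed.

Definition nb_split n := count split_word (king_words n).

(** The index [a] is the length of the first factor, one more than the first letter. The subtracted
    term discards the one-letter factor, so this is the convolution for (B - t) B. *)
Lemma nb_splitE n : nb_split n =
  \sum_(a < n.+1) (nb_king_from0 a - (a == 1 :> nat)) * nb_king_from0 (n - a).
Proof.
pose L := [seq w <- king_words n | split_word w].
have LE w : (w \in L) = [&& perm_eq w (iota 0 n), sorted far w & split_word w].
  by rewrite !mem_filter mem_permutations andbC -andbA andbCA.
have UL : uniq L by rewrite !filter_uniq ?permutations_uniq.
rewrite /nb_split -size_filter -/L -sum1_size.
rewrite (partition_big (fun w => inord (head 0 w).+1 : 'I_n.+1) xpredT) //=.
apply: eq_bigr => -[a lta] _ /=; rewrite sum1_count -size_filter.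
pose X := if 1 < a then [seq x <- permutations (iota 0 a) | king_from a.-1 x] else [::].
pose Y := [seq y <- permutations (iota a (n - a)) | king_from a y].
have sX : size X = nb_king_from0 a - (a == 1).
  rewrite /X; case: ltnP => [a1 | ].
    by rewrite size_filter count_king_from_max gtn_eqF ?subn0.
  by case: a {lta X Y} => [|[|]].
have XE x : (x \in X) = [&& 1 < a, perm_eq x (iota 0 a) & king_from a.-1 x].
  by rewrite /X; case: ifP => // _; rewrite mem_filter mem_permutations andbC.
have YE y : (y \in Y) = perm_eq y (iota a (n - a)) && king_from a y.
  by rewrite mem_filter mem_permutations andbC.
rewrite -sX -(count_king_from a) -size_filter -/Y -(size_allpairs cat).
apply/perm_size/uniq_perm => [||w]; first by rewrite filter_uniq.
  apply: allpairs_uniq.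
  - by rewrite /X; case: ifP => // _; rewrite filter_uniq ?permutations_uniq.
  - by rewrite filter_uniq ?permutations_uniq.
  move=> [x y] [x' y'] /allpairsP[[? ?] [/= + _ [-> _]]] /allpairsP[[? ?] [/= + _ [-> _]]].
  rewrite !XE => /and3P[_ px _] /and3P[_ px' _] /= /eqP.
  (* Both first factors have length [a], so the concatenation determines the pair. *)
  rewrite eqseq_cat; last by rewrite (perm_size px) (perm_size px').
  by case/andP=> /eqP-> /eqP->.
rewrite mem_filter LE; apply/idP/allpairsP.
  case/and4P=> /eqP ea pw sw spw.
  have [] := split_word_inv pw sw spw; set b := (head 0 w).+1 => b1 le_b [px kx] [py ky].
  (* [inord] does not fall back to its default here, because b is at most n. *)
  have eb : b = a by have := congr1 val ea; rewrite /= inordK ?ltnS.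
  rewrite {}eb in b1 le_b px kx py ky.
  by exists (take a w, drop a w); rewrite /= XE YE b1 px kx py ky cat_take_drop.
case=> -[x y] /= []; rewrite XE YE => /and3P[a1 px kx] /andP[py ky] ->.
have [-> -> -> ->] := king_from_cat a1 lta px kx py ky.
by rewrite !andbT; apply/eqP/val_inj; rewrite /= inordK.
Qed.

(** * Evaluation of the initial terms *)

(** Extends the word letter by letter and prunes at the first pair that is not far, so the kings up
    to length 8 can be counted without listing all permutations. [m] is fuel, meant to be the size
    of [s]. *)
Fixpoint count_paths m x (s : seq nat) :=
  if m is m'.+1 then sumn [seq count_paths m' y (rem y s) | y <- s & far x y] else 1.

Lemma count_pathsE m x s : uniq s -> size s = m ->
  count_paths m x s = count (path far x) (permutations s).
Proof.
elim: m x s => [|m IHm] x s Us sz; first by rewrite (size0nil sz).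
rewrite (seq.permP (permutationsE _)) ?sz // undup_id // count_flatten -map_comp /=.
rewrite !sumnE !big_map big_filter big_mkcond /= big_seq [RHS]big_seq.
apply: eq_bigr => y sy /=; rewrite count_map.
case: ifPn => [fxy | /negbTE nfxy].
  rewrite IHm ?rem_uniq ?size_rem ?sz //.
  by apply: eq_count => w /=; rewrite fxy.
by rewrite -[LHS](count_pred0 (permutations (rem y s))); apply: eq_count => w /=; rewrite nfxy.
Qed.

(* The virtual letter n.+1 is far from all letters of the word. *)
Lemma size_king_words n : size (king_words n) = count_paths n n.+1 (iota 0 n).
Proof.
rewrite count_pathsE ?iota_uniq ?size_iota // size_filter.
apply: eq_in_count => -[|x w] //; rewrite mem_permutations => pw.
have : x \in iota 0 n by rewrite -(perm_mem pw) mem_head.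
by rewrite mem_iota /= /far !ltnS => ->; rewrite orbT.
Qed.

(** The relation (1 + t) B = t A solved coefficient by coefficient; by [nb_king_from0_rec] the
    natural subtraction never truncates. *)
Fixpoint king_from0_count n :=
  if n is m.+1 then count_paths m n (iota 0 m) - king_from0_count m else 0.

Lemma nb_king_from0_compute : nb_king_from0 =1 king_from0_count.
Proof.
by elim=> //= n <-; rewrite -size_king_words -nb_king_from0_rec addnK.
Qed.

Lemma nb_split_compute n : nb_split n =
  sumn [seq (king_from0_count a - (a == 1)) * king_from0_count (n - a)
       | a <- iota 0 n.+1].
Proof.
rewrite nb_splitE sumnE big_map -[iota 0 n.+1]/(index_iota 0 n.+1) big_mkord.
by apply: eq_bigr => a _; rewrite !nb_king_from0_compute.
Qed.

(** Each pair holds the coefficients of u^0 and u^1. *)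
Lemma initial_counts :
  [seq (size (king_words n) - nb_split n, nb_split n) | n <- iota 0 9] =
  [:: (1, 0); (1, 0); (0, 0); (0, 0); (2, 0); (14, 0); (88, 2); (634, 12); (5164, 78)].
Proof.
under eq_map => n do rewrite size_king_words nb_split_compute.
by vm_compute.
Qed.

Local Open Scope ring_scope.

(** * Translation into generating functions *)

Lemma fps_mulX (R : unitRingType) (f : fps R) n :
  ('t * f)%fps n = if n is m.+1 then f m else 0.
Proof.
rewrite /fps_mul; case: n => [|n]; first by rewrite big_ord1 mul0r.
rewrite 2!big_ord_recl /= mul0r add0r mul1r subSS subn0 big1 ?addr0 // => i _.
by rewrite mul0r.
Qed.

(** Constancy of [c] is expressed by its coefficients, so that it also covers the difference 1 - u
    of two constant series. *)
Lemma fps_mulCl (R : unitRingType) (c f : fps R) n :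
  (forall i, c i.+1 = 0) -> (c * f)%fps n = c 0%N * f n.
Proof.
move=> c0; rewrite /fps_mul big_ord_recl subn0 big1 ?addr0 // => i _.
by rewrite c0 mul0r.
Qed.

Section KingGf.
Variable R : comUnitRingType.

Let A : fps (R : unitRingType) := king_gf R.
Let B : fps (R : unitRingType) := fun n => (nb_king_from0 n)%:R.

Lemma king_gfE n : A n = (size (king_words n))%:R.
Proof.
rewrite /A /king_gf -[size _](count_predT) -card_kings; congr (_%:R).
by apply: eq_card => s; rewrite !inE andbT.
Qed.

Lemma king_from0_gf : (B + 't * B =1 't * A)%fps.
Proof.
move=> n; rewrite /fps_add !fps_mulX; case: n => [|n].
  by rewrite addr0 /B nb_king_from0_0.
by rewrite king_gfE -nb_king_from0_rec natrD.
Qed.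

Lemma split_gf n : ((B - 't) * B)%fps n = (nb_split n)%:R.
Proof.
rewrite nb_splitE natr_sum; apply: eq_bigr => -[a lta] _ /=.
(* The natural subtraction is exact: there is one king of length 1 and it starts with 0. *)
by rewrite natrM natrB //; case: eqP => // ->.
Qed.

(** Common source of both formulas, with c = 1 for avoidance and c = 1 - u for the distribution. *)
Lemma king_split_gf (c q : fps (R : unitRingType)) n :
    (forall i, c i.+1 = 0) -> (q =1 't ^+ 2 * c)%fps ->
  ((1 + q / (1 + 't) - q * A / (1 + 't) ^+ 2) * A)%fps n =
  (size (king_words n))%:R - c 0%N * (nb_split n)%:R.
Proof.
move=> c0 qE; rewrite -(fps_distribution_identity king_from0_gf qE).
by rewrite /fps_add /fps_opp fps_mulCl // split_gf king_gfE.
Qed.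

End KingGf.

Lemma avoid_gfE n : avoid_gf pat n = (size (king_words n))%:R - (nb_split n)%:R.
Proof.
rewrite /avoid_gf -[size _](count_predC split_word) natrD -/(nb_split n).
rewrite [X in X - _]addrC addrK.
rewrite -card_kings; congr (_%:R); apply: eq_card => s.
by rewrite !inE nb_occ_word eqb0.
Qed.

(** Each king contributes u^b = 1 - (1 - u) b, where b is 0 or 1. *)
Lemma distr_gfE n :
  distr_gf pat n = (size (king_words n))%:R - (1 - 'X) * (nb_split n)%:R.
Proof.
transitivity (\sum_(w <- king_words n) ('X ^+ split_word w : {poly int})).
  by rewrite -sum_kings; apply: eq_bigr => s _; rewrite nb_occ_word.
rewrite /nb_split; elim: (king_words n) => [|w l IHl].
  by rewrite big_nil mulr0 subr0.
rewrite big_cons IHl /= -[(size l).+1]add1n !natrD mulrDr opprD addrACA.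
congr (_ + _); case: (split_word w); first by rewrite mulr1 opprB addrC subrK.
by rewrite mulr0 subr0.
Qed.

Theorem theorem3p6 :
  [/\ (let A := king_gf int in
       avoid_gf pat =1
         ((1 + 't ^+ 2 / (1 + 't) - 't ^+ 2 * A / (1 + 't) ^+ 2) * A)%fps),
      (let A := king_gf {poly int} in
       let u := fpsC ('X : {poly int}) in
       distr_gf pat =1
         ((1 + 't ^+ 2 * (1 - u) / (1 + 't)
             - 't ^+ 2 * (1 - u) * A / (1 + 't) ^+ 2) * A)%fps)
    & [seq distr_gf pat n | n <- iota 0 9] =
      [:: 1; 1; 0; 0; 2; 14; 88 + 2 * 'X; 634 + 12 * 'X; 5164 + 78 * 'X]].
Proof.
split=> [A n | A u n |].
- rewrite (king_split_gf (c := fpsC 1)) // => [|m]; last by rewrite fps_mulC fps_mul1.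
  by rewrite mul1r avoid_gfE.
- rewrite (king_split_gf (c := (1 - u)%fps)) //.
    exact: distr_gfE.
  by move=> i; rewrite /fps_add /fps_opp /= subr0.
(* Regrouped by powers of u, to match the pairs in [initial_counts]. *)
have distrE n : distr_gf pat n =
    (size (king_words n) - nb_split n)%:R + (nb_split n)%:R * 'X.
  rewrite natrB ?count_size // distr_gfE mulrBl mul1r opprB.
  by rewrite ['X * _]mulrC [_ * 'X - _]addrC addrA.
rewrite (eq_map distrE).
rewrite (map_comp (fun kd => kd.1%:R + kd.2%:R * 'X : {poly int})
  (fun n => (size (king_words n) - nb_split n, nb_split n))%N) initial_counts /=.
by rewrite !mul0r !addr0.
Qed.
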